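(* If $q$ is a prime number with $q\equiv 1\pmod 4$ and $q\neq 5$, then the Paley graph $P(q)$ is pancyclic.
   Context: For a prime power $q\equiv 1\pmod 4$, let $\mathbb{F}_q$ be the finite field of order $q$ and let $(\mathbb{F}_q^* )^2$ be the set of nonzero squares (quadratic residues) of $\mathbb{F}_q$. The Paley graph $P(q)$ is the simple undirected graph with vertex set $\mathbb{F}_q$ in which $u$ and $v$ are adjacent if and only if $u-v\in(\mathbb{F}_q^* )^2$ (this is the Cayley graph $\mathrm{Cay}(\mathbb{F}_q,(\mathbb{F}_q^* )^2)$ of the additive group of $\mathbb{F}_q$). An undirected graph of order $n\ge 3$ is pancyclic if it contains a $k$-cycle as a (not necessarily induced) subgraph for every $k\in\{3,4,\ldots,n\}$. *)

(* Defs.v *)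
From mathcomp Require Import all_boot all_order all_fingroup all_algebra all_solvable all_field.
Set Implicit Arguments.
Unset Strict Implicit.
Unset Printing Implicit Defensive.

Import GRing.Theory.
Local Open Scope ring_scope.

(* A simple undirected graph on T is given by its adjacency relation, a
   symmetric irreflexive [rel T]; #|T| is the order of the graph. *)
Definition simple_graph (T : finType) (e : rel T) : Prop :=
  symmetric e /\ irreflexive e.

(* [ucycle e c] says that the vertices of c are distinct and cyclically
   consecutive ones are adjacent. For k >= 3 this is a k-cycle, not necessarily
   induced; for k < 3 it is not one, and pancyclicity does not use it. *)
Definition has_cycle (T : finType) (e : rel T) (k : nat) : Prop :=
  exists2 c : seq T, size c = k & ucycle e c.

Definition pancyclic (T : finType) (e : rel T) : Prop :=
  (3 <= #|T|)%N /\ forall k : nat, (3 <= k <= #|T|)%N -> has_cycle e k.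

Definition nonzero_squares (F : finFieldType) : {set F} :=
  [set x ^+ 2 | x : F & x != 0].

(* Meaningful when #|F| = 1 %[mod 4]: see [paley_simple] below. *)
Definition paley (F : finFieldType) : rel F :=
  fun u v => u - v \in nonzero_squares F.
Arguments paley F u v : clear implicits.

Lemma m1_square (F : finFieldType) :
  #|F| = 1 %[mod 4] -> exists2 i : F, i != 0 & i ^+ 2 = -1.
Proof.
move=> F1.
have /cyclicP[g defG] : cyclic [set: {unit F}] := field_unit_group_cyclic _.
have F_gt1 : (1 < #|F|)%N := finNzRing_gt1 F.
have og : #[g]%g = #|F|.-1 by rewrite orderE -defG card_finField_unit.
have [m Em] : exists m, #|F|.-1 = (m * 4)%N.
  by apply/dvdnP; rewrite -subn1 -eqn_mod_dvd 1?ltnW //; apply/eqP.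
have m_gt0 : (0 < m)%N by case: m Em => // Em; case: #|F| F_gt1 Em => [|[]].
pose i : F := FinRing.uval (g ^+ m)%g.
have iX n : i ^+ n = FinRing.uval (g ^+ (m * n))%g.
  by rewrite expgM FinRing.val_unitX.
have i4 : i ^+ 4 = 1 by rewrite iX -Em -og expg_order FinRing.val_unit1.
have i2 : i ^+ 2 != 1.
  apply/eqP; rewrite iX -FinRing.val_unit1 => /val_inj/eqP.
  rewrite -order_dvdn og Em => /dvdn_leq.
  by rewrite muln_gt0 m_gt0 leq_pmul2l // => /(_ isT).
exists i.
  by apply/eqP => i0; move/eqP: i4; rewrite i0 expr0n eq_sym oner_eq0.
have /eqP : (i ^+ 2 - 1) * (i ^+ 2 + 1) = 0.
  by rewrite -subr_sqr -exprM i4 expr1n subrr.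
by rewrite mulf_eq0 subr_eq0 (negPf i2) /= addr_eq0 => /eqP.
Qed.

Lemma paley_simple (F : finFieldType) :
  #|F| = 1 %[mod 4] -> simple_graph (paley F).
Proof.
move=> /m1_square[i i0 i2]; split; last first.
  move=> u; apply/imsetP => -[x]; rewrite inE subrr => x0 /esym/eqP.
  by rewrite expf_eq0 (negPf x0).
have imp u v : paley F u v -> paley F v u.
  move=> /imsetP[x]; rewrite inE => x0 uv; apply/imsetP; exists (i * x).
    by rewrite inE mulf_neq0.
  by rewrite exprMn i2 mulN1r -uv opprB.
by move=> u v; apply/idP/idP; apply: imp.
Qed.

(* Main.v *)
Require Import Defs.
From mathcomp Require Import all_boot all_order all_fingroup all_algebra all_solvable all_field.
From mathcomp Require Import zify.

(** In the Paley graph of a prime field of order q > 5 the residues 1, 4, 9, 16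
    and 25 are nonzero squares.  Hence 0, 9, 25 is a triangle, because
    9 + 16 = 25, and 0, 1, ..., q - 1 is a Hamiltonian cycle.

    The other cycles are drawn on the natural numbers, where m and n are joined
    when they differ by 1 or by 4: reduction mod q sends a cycle through numbers
    below q to a cycle of the same length ([natural_cycle_paley]).  Writing the
    naturals in rows of four consecutive numbers makes this graph a grid of
    width 4 (up to additional edges).  If a cycle stays within the rows up to
    n, n+1, n+2, n+3 and uses the edges n -- n+1 and n+2 -- n+3, both edges can
    be pulled up through the next row n+4, ..., n+7, which lengthens the cycle
    by 4 and reproduces the same situation ([weavable_next_row]).  One starting
    cycle for each residue of the length mod 4 then gives the length 5 and every
    length k >= 7 ([weavable_length]); the two lengths 4 and 6 that fall between
    have small cycles of their own.

    The cycle of length k occupies an interval of length k, k + 3, k + 2, k when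
    k is 0, 1, 2, 3 mod 4.  As q is 1 mod 4, each of these is at most q as soon as
    k < q: the next number that is 1 mod 4 after k < q leaves that much room. *)

Set Implicit Arguments.
Unset Strict Implicit.
Unset Printing Implicit Defensive.

Import GRing.Theory.

(** * Cycles on the natural numbers with differences 1 and 4 *)

Definition differ14 : rel nat := fun m n =>
  [|| n == m + 1, m == n + 1, n == m + 4 | m == n + 4].

(** Deleting the edges n -- n+1 and n+2 -- n+3 from the cycle leaves the paths
    n+1, p, n+2 and n+3, r, n; recording these paths rather than the cycle makes
    the passage to the next row a mere extension at both ends. *)
Definition weavable (n k : nat) : Prop :=
  exists p r : seq nat,
    let c := (n.+1 :: rcons p n.+2) ++ (n.+3 :: rcons r n) in
    [/\ path differ14 n.+1 (rcons p n.+2), path differ14 n.+3 (rcons r n),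
        uniq c, all (ltn^~ n.+4) c & size c = k].

(** The new row is attached as n+5, n+1, ..., n+2, n+6 and
    n+7, n+3, ..., n, n+4. *)
Lemma weavable_next_row n k : weavable n k -> weavable n.+4 k.+4.
Proof.
case=> p [r []]; set P := n.+1 :: _; set R := n.+3 :: _ => pP pR Uc bc sz.
have perm : perm_eq ((n.+4.+1 :: rcons P n.+4.+2) ++ n.+4.+3 :: rcons R n.+4)
                    ([:: n.+4; n.+4.+1; n.+4.+2; n.+4.+3] ++ (P ++ R)).
  apply/seq.permP => a; rewrite /= !count_cat /= -!cats1 !count_cat /=; lia.
exists P, R; split.
- rewrite rcons_path /= pP last_rcons /differ14; lia.
- rewrite rcons_path /= pR last_rcons /differ14; lia.
- rewrite (perm_uniq perm) cat_uniq Uc andbT; apply/andP; split.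
    by rewrite /= !inE; lia.
  apply/hasPn => x /(allP bc) /=; rewrite !inE; lia.
- rewrite (perm_all _ perm) all_cat; apply/andP; split; first by rewrite /=; lia.
  by apply: sub_all bc => x /=; lia.
- by rewrite (perm_size perm) size_cat sz.
Qed.

Lemma weavable_rows n k m : weavable n k -> weavable (m * 4 + n) (m * 4 + k).
Proof. by move=> nk; elim: m => // m /weavable_next_row; rewrite mulSn. Qed.

(** The list records by how much the interval [0, n + 4) exceeds the length of
    the cycle, which depends only on the length mod 4: a new row adds 4 to both.
    The starting cycles have lengths 8, 5, 10 and 7. *)
Lemma weavable_length k : (7 <= k) || (k == 5) ->
  exists2 n, weavable n k & n + 4 = k + nth 0 [:: 0; 3; 2; 0] (k %% 4).
Proof.
have base n0 k0 : weavable n0 k0 -> k0 <= k -> k = k0 %[mod 4] ->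
    n0 + 4 = k0 + nth 0 [:: 0; 3; 2; 0] (k0 %% 4) ->
  exists2 n, weavable n k & n + 4 = k + nth 0 [:: 0; 3; 2; 0] (k %% 4).
  move=> w0 le_k0 kmod n0E; exists ((k - k0) %/ 4 * 4 + n0).
    have -> : weavable ((k - k0) %/ 4 * 4 + n0) k =
              weavable ((k - k0) %/ 4 * 4 + n0) ((k - k0) %/ 4 * 4 + k0).
      by congr weavable; lia.
    exact: weavable_rows.
  by rewrite kmod; lia.
move=> k_range.
have : [|| k %% 4 == 0, k %% 4 == 1, k %% 4 == 2 | k %% 4 == 3] by lia.
case/or4P=> /eqP Ek.
- apply: (base 4 8); rewrite ?Ek //; last lia.
  by exists [::], [:: 3; 2; 1; 0].
- apply: (base 4 5); rewrite ?Ek //; last lia.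
  by exists [::], [:: 3].
- apply: (base 8 10); rewrite ?Ek //; last lia.
  by exists [::], [:: 7; 6; 5; 1; 0; 4].
- apply: (base 3 7); rewrite ?Ek //.
  + by exists [:: 0; 1], [:: 2].
  + lia.
Qed.

Lemma weavable_cycle n k : weavable n k ->
  exists c, [/\ size c = k, all (ltn^~ (n + 4)) c & ucycle differ14 c].
Proof.
case=> p [r [pP pR Uc bc sz]]; eexists; split; [exact: sz| by rewrite addn4|].
apply/andP; split => //.
rewrite /= rcons_cat cat_path pP /= last_rcons rcons_path pR last_rcons.
by rewrite /differ14; lia.
Qed.

(** * Reduction modulo a prime *)

Local Open Scope ring_scope.

Lemma natr_Fp_inj p : prime p ->
  {in gtn p &, injective (fun n : nat => n%:R : 'F_p)}.
Proof.
move=> pp m n; rewrite !inE => mp np /(congr1 val) /=.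
by rewrite !val_Fp_nat // !modn_small.
Qed.

Lemma natr_Fp_neq0 p n : prime p -> (0 < n < p)%N -> n%:R != 0 :> 'F_p.
Proof.
move=> pp np; apply/eqP => /(@natr_Fp_inj p pp n 0); rewrite !inE.
by lia.
Qed.

Lemma paley_add_sqr p (x a : nat) : prime p -> (0 < a < p)%N ->
  paley 'F_p (x + a ^ 2)%:R x%:R.
Proof.
move=> pp ap; apply/imsetP; exists a%:R.
  by rewrite inE; apply: natr_Fp_neq0.
by rewrite natrD addrAC subrr add0r natrX.
Qed.

Lemma paley_sym p : prime p -> p = 1 %[mod 4] -> symmetric (paley 'F_p).
Proof.
move=> pp p4; have [symP _] // : simple_graph (paley 'F_p).
by apply: paley_simple; rewrite card_Fp.
Qed.

Lemma differ14_paley p m n : prime p -> p = 1 %[mod 4] ->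
  differ14 m n -> paley 'F_p m%:R n%:R.
Proof.
move=> pp p4.
have p2 : (2 < p)%N by have := prime_gt1 pp; lia.
have up1 x : paley 'F_p (x + 1)%:R x%:R by apply: (@paley_add_sqr p x 1); lia.
have up4 x : paley 'F_p (x + 4)%:R x%:R by apply: (@paley_add_sqr p x 2); lia.
by case/or4P => /eqP->; rewrite ?up1 ?up4 // paley_sym // ?up1 ?up4.
Qed.

Lemma natural_cycle_paley p c : prime p -> p = 1 %[mod 4] ->
  all (ltn^~ p) c -> ucycle differ14 c -> has_cycle (paley 'F_p) (size c).
Proof.
move=> pp p4 /allP bc /andP[cc Uc].
exists [seq n%:R | n <- c]; first by rewrite size_map.
apply/andP; split.
  rewrite cycle_map; apply: sub_cycle cc => m n; exact: differ14_paley.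
rewrite map_inj_in_uniq // => m n /bc mp /bc np; exact: natr_Fp_inj.
Qed.

Lemma paley_hamiltonian p : prime p -> p = 1 %[mod 4] ->
  has_cycle (paley 'F_p) p.
Proof.
move=> pp p4; have p_gt0 := prime_gt0 pp.
exists [seq n%:R | n <- iota 0 p]; first by rewrite size_map size_iota.
apply/andP; split; last first.
  rewrite map_inj_in_uniq ?iota_uniq // => m n; rewrite !mem_iota => mp np.
  exact: natr_Fp_inj.
have -> : iota 0 p = 0%N :: iota 1 p.-1 by rewrite -[in LHS](prednK p_gt0).
rewrite /= rcons_path path_map; apply/andP; split.
  apply: (@sub_path _ differ14) => [m n|]; first exact: differ14_paley.
  by elim: p.-1 0%N => //= m IHm n; rewrite IHm /differ14 addn1 eqxx.
rewrite last_map.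
have -> : last 0%N (iota 1 p.-1) = p.-1.
  by rewrite (last_nth 0%N) -/(iota 0 p.-1.+1) size_iota nth_iota.
have p0 : p%:R = 0 :> 'F_p by apply/eqP; rewrite -(dvdn_pcharf (pchar_Fp pp)).
rewrite paley_sym // -[X in paley _ X _]p0.
by have := @paley_add_sqr p p.-1 1 pp (prime_gt1 pp); rewrite addn1 prednK.
Qed.

(** This is where the Pythagorean triple enters: differences 1 and 4 alone
    need not produce a triangle. *)
Lemma paley_triangle p : prime p -> p = 1 %[mod 4] -> (5 < p)%N ->
  has_cycle (paley 'F_p) 3.
Proof.
move=> pp p4 p5.
have a1 : paley 'F_p 9%:R 0%:R by apply: (@paley_add_sqr p 0 3); lia.
have a2 : paley 'F_p 25%:R 9%:R by apply: (@paley_add_sqr p 9 4); lia.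
have a3 : paley 'F_p 25%:R 0%:R by apply: (@paley_add_sqr p 0 5); lia.
have [symP irrP] : simple_graph (paley 'F_p) by apply: paley_simple; rewrite card_Fp.
have adj_neq u v : paley 'F_p u v -> u != v.
  by move=> uv; apply/eqP => Euv; rewrite Euv irrP in uv.
exists [:: 0%:R; 9%:R; 25%:R] => //; apply/andP; split.
  by rewrite /= a3 symP a1 symP a2.
by rewrite /= !inE negb_or eq_sym adj_neq // eq_sym adj_neq // eq_sym adj_neq.
Qed.

Theorem corollary1p2 (q : nat) (hq : prime q) (hq4 : q = 1 %[mod 4])
  (hq5 : q <> 5) : pancyclic (paley 'F_q).
Proof.
have q_gt9 : (9 < q)%N.
  case: (ltnP 9 q) => // q9; move: hq hq4 hq5.
  by move: q q9 => [|[|[|[|[|[|[|[|[|[|]]]]]]]]]].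
split=> [|k]; rewrite card_Fp //; first by lia.
case/andP=> k3; rewrite leq_eqVlt => /predU1P[-> | kq].
  exact: paley_hamiltonian.
have [-> | k_neq3] := eqVneq k 3; first by apply: paley_triangle; lia.
have [-> | k_neq4] := eqVneq k 4.
  by apply: (@natural_cycle_paley q [:: 0; 1; 5; 4]); rewrite //=; lia.
have [-> | k_neq6] := eqVneq k 6.
  by apply: (@natural_cycle_paley q [:: 0; 1; 5; 9; 8; 4]); rewrite //=; lia.
have [|n kn nE] := @weavable_length k; first by lia.
have n_le : (n + 4 <= q)%N.
  have := ltn_pmod k (isT : 0 < 4)%N; rewrite nE.
  by case Ek: (k %% 4)%N => [|[|[|[|//]]]] _ /=; lia.
have [c [<- bc cc]] := weavable_cycle kn.
apply: natural_cycle_paley => //.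
by apply: sub_all bc => x /= /leq_trans; apply.
Qed.
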